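(* Let $k\in\mathbb{Z}$ and let $\phi(z)=z^2+\frac{k}{4}$. If $k\equiv 0$ or $1\pmod 4$, then there exist $B,C\in\mathbb{Z}$ such that $\phi(z)$ is conjugate to $z^2+Bz+C$, which has good reduction (over $\mathbb{Q}$).
   Context: Two rational maps $\phi,\psi\in\mathbb{Q}(z)$ are conjugate if $\psi=\phi^f=f^{-1}\circ\phi\circ f$ for some $f\in\mathrm{PGL}_2(\mathbb{Q})$. For a prime $p$, write $\psi=F/G$ with all coefficients of $F,G$ $p$-integral and at least one a $p$-adic unit; $\psi$ has good reduction at $p$ if the rational map $\tilde\psi$ over $\mathbb{F}_p$ obtained by reducing the coefficients modulo $p$ (and cancelling common factors) satisfies $\deg\tilde\psi=\deg\psi$. $\psi$ has good reduction over $\mathbb{Q}$ if it has good reduction at every prime $p$. *)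

(* Defs.v *)
From HB Require Import structures.
From mathcomp Require Import all_boot all_order all_algebra.

Set Implicit Arguments.
Unset Strict Implicit.
Unset Printing Implicit Defensive.

Import Order.TTheory GRing.Theory Num.Theory.
Local Open Scope ring_scope.
Local Open Scope quotient_scope.

Notation "x %:F" := (@FracField.tofrac _ x) : ring_scope.

(* Elements of Q(z); the only rational map of P^1 left out is the constant
   map infinity. *)
Definition ratmap := {fraction {poly rat}}.

Definition poly_at (F : {poly rat}) (g : ratmap) : ratmap :=
  (map_poly (fun c : rat => (c%:P)%:F) F).[g].

(* For nonconstant g the denominator is nonzero and the value does not depend
   on the representative; only that case is used below. *)
Definition ratcomp (phi g : ratmap) : ratmap :=
  poly_at \n_(repr phi) g / poly_at \d_(repr phi) g.

Definition moebius (M : 'M[rat]_2) (w : ratmap) : ratmap :=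
  (((M 0 0)%:P)%:F * w + ((M 0 1)%:P)%:F) /
  (((M 1 0)%:P)%:F * w + ((M 1 1)%:P)%:F).

(* phi^f = f^-1 o phi o f, where f is the class of M in PGL_2(Q). *)
Definition conj_ratmap (phi : ratmap) (M : 'M[rat]_2) : ratmap :=
  moebius (invmx M) (ratcomp phi (moebius M ('X)%:F)).

(* The value of conj_ratmap depends only on the class of M modulo scalars.
   The outer denominator can vanish only when phi is constant, and then the
   default value 0 does no harm, as any two constants in Q are conjugate. *)
Definition conjugate (phi psi : ratmap) : Prop :=
  exists2 M : 'M[rat]_2, M \in unitmx & psi = conj_ratmap phi M.

(* Degree of the rational map [F : G], for F and G not both 0, after
   cancelling common factors; G = 0 gives the constant map infinity. *)
Definition frac_deg (K : fieldType) (F G : {poly K}) : nat :=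
  (maxn (size (F %/ gcdp F G)) (size (G %/ gcdp F G))).-1.

Definition p_integral (p : nat) (x : rat) : bool := ~~ (p %| denq x)%Z.

Definition p_unit (p : nat) (x : rat) : bool :=
  p_integral p x && ~~ (p %| numq x)%Z.

(* On p-integral rationals, ratr : rat -> 'F_p is reduction modulo p. *)
Definition reduce (p : nat) (F : {poly rat}) : {poly 'F_p} :=
  map_poly (ratr : rat -> 'F_p) F.

(* By Gauss's lemma the last condition does not depend on the choice of F, G,
   which need not be coprime since frac_deg cancels common factors. *)
Definition good_reduction_at (p : nat) (psi : ratmap) : Prop :=
  exists F G : {poly rat},
    [/\ G != 0,
        psi = F%:F / G%:F,
        forall i, p_integral p F`_i && p_integral p G`_i,
        exists i, p_unit p F`_i || p_unit p G`_i
      & frac_deg (reduce p F) (reduce p G) = frac_deg F G].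

Definition good_reduction (psi : ratmap) : Prop :=
  forall p : nat, prime p -> good_reduction_at p psi.

(* Main.v *)
Require Import Defs.
From HB Require Import structures.
From mathcomp Require Import all_boot all_order all_algebra.
From mathcomp Require Import ring.

(** Conjugating z^2 + c by the translation z |-> z + b gives
    z^2 + 2b z + (b^2 - b + c).  For c = k/4 both coefficients are integers
    when b = 0 and k = 0 (mod 4), or b = 1/2 and k = 1 (mod 4): in the second
    case b^2 - b = -1/4 turns the constant term into (k - 1)/4.

    A monic polynomial with integer coefficients has good reduction everywhere
    ([monic_int_good_reduction]): its leading coefficient survives reduction
    modulo every prime, and over the denominator 1 there is no common factor
    to cancel, so the degree of the map is the degree of the polynomial both
    before and after reduction.

    What remains is to compute the conjugate in the field of fractions
    ([conj_ratmap_translation]).  There composition is defined through a chosen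
    representative of the map, not necessarily F / 1; it is n / d with n = F d,
    and d does not vanish at z + b. *)

Set Implicit Arguments.
Unset Strict Implicit.
Unset Printing Implicit Defensive.

Import Order.TTheory GRing.Theory Num.Theory.
Local Open Scope ring_scope.

(** * Conjugation of a polynomial map by a translation *)

Lemma numer_repr_tofrac (R : idomainType) (F : R) :
  \n_(repr F%:F) = F * \d_(repr F%:F).
Proof.
have := FracField.equivf_l (Ratio F 1).
rewrite !numden_Ratio ?oner_eq0 // mulr1 [RHS]mulrC.
by rewrite [F%:F]piE.
Qed.

Lemma poly_at_tofrac (F q : {poly rat}) : poly_at F q%:F = (F \Po q)%:F.
Proof.
rewrite /poly_at /comp_poly -horner_map -map_poly_comp.
by congr horner.
Qed.

(** The denominator d of the representative cancels because d \Po q is nonzero,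
    which needs q to be nonconstant: d may have rational roots. *)
Lemma ratcomp_tofrac (F q : {poly rat}) :
  (1 < size q)%N -> ratcomp F%:F q%:F = (F \Po q)%:F.
Proof.
move=> q_nonconst; rewrite /ratcomp numer_repr_tofrac !poly_at_tofrac.
by rewrite comp_polyM tofracM mulfK // tofrac_eq0 comp_poly_eq0 ?denom_ratioP.
Qed.

Definition translation_mx (b : rat) : 'M[rat]_2 :=
  \matrix_(i, j) (if i == j then 1 else if i == 0 then b else 0).

Lemma mul_translation_mx a b :
  translation_mx a *m translation_mx b = translation_mx (a + b).
Proof.
apply/matrixP => i j; rewrite !mxE !big_ord_recl big_ord0 !mxE.
by case: i j => [[|[|//]] ?] [[|[|//]] ?];
  rewrite /= ?(mul0r, mul1r, mulr0, mulr1, addr0, add0r) // addrC.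
Qed.

Lemma translation_mx0 : translation_mx 0 = 1%:M.
Proof. by apply/matrixP => i j; rewrite !mxE if_same; case: eqP. Qed.

Lemma unit_translation_mx b : translation_mx b \in unitmx.
Proof.
have /mulmx1_unit[] // : translation_mx b *m translation_mx (- b) = 1%:M.
by rewrite mul_translation_mx subrr translation_mx0.
Qed.

Lemma invmx_translation b : invmx (translation_mx b) = translation_mx (- b).
Proof.
apply: (can_inj (mulKmx (unit_translation_mx b))).
by rewrite mulmxV ?unit_translation_mx // mul_translation_mx subrr
           translation_mx0.
Qed.

Lemma moebius_translation b (F : {poly rat}) :
  moebius (translation_mx b) F%:F = (F + b%:P)%:F.
Proof.
by rewrite /moebius !mxE /= !rmorph1 !rmorph0 mul0r mul1r add0r divr1 rmorphD.
Qed.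

Lemma conj_ratmap_translation (F : {poly rat}) b :
  conj_ratmap F%:F (translation_mx b) = (F \Po ('X + b%:P) - b%:P)%:F.
Proof.
rewrite /conj_ratmap moebius_translation ratcomp_tofrac ?size_XaddC //.
by rewrite invmx_translation moebius_translation polyCN.
Qed.

Lemma conjugate_quadratic (b c : rat) :
  conjugate ('X^2 + c%:P)%:F
            ('X^2 + (b *+ 2) *: 'X + (b ^+ 2 - b + c)%:P)%:F.
Proof.
exists (translation_mx b); first exact: unit_translation_mx.
rewrite conj_ratmap_translation; congr (_%:F).
rewrite comp_polyD comp_Xn_poly comp_polyC -mul_polyC.
by rewrite !(polyCD, polyCN, polyCMn, rmorphXn) /=; ring.
Qed.

(** * Good reduction of monic integral polynomials *)

Lemma frac_deg_poly (K : fieldType) (F : {poly K}) :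
  F != 0 -> frac_deg F 1 = (size F).-1.
Proof.
move=> F0; rewrite /frac_deg.
have gF : size (gcdp F 1) = 1%N by rewrite size_gcdp1.
have g0 : gcdp F 1 != 0 by rewrite -size_poly_eq0 gF.
by rewrite !size_divp // gF !subn0 size_poly1 (maxn_idPl _) // size_poly_gt0.
Qed.

Lemma p_integral_int p (n : int) : prime p -> p_integral p n%:~R.
Proof.
by move=> p_pr; rewrite /p_integral denq_int dvdz1; case: p p_pr => [|[]].
Qed.

(** In characteristic p, ratr is not a ring morphism on all of Q, so the
    coefficients are compared one by one; on integers it is the usual cast. *)
Lemma reduce_int p (Q : {poly int}) :
  reduce p (map_poly intr Q) = map_poly intr Q.
Proof.
apply/polyP => i; rewrite /reduce coef_map_id0 ?(ratr_int _ 0) //.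
by rewrite !coef_map /= ratr_int.
Qed.

(** Being monic is what keeps the degree: the leading coefficient 1 is nonzero
    in every field. *)
Lemma monic_int_good_reduction (Q : {poly int}) :
  Q \is monic -> good_reduction (map_poly intr Q)%:F.
Proof.
move=> Qmonic p p_pr.
have size_intr (K : fieldType) : size (map_poly intr Q : {poly K}) = size Q.
  by apply: size_map_poly_id0; rewrite (monicP Qmonic) oner_eq0.
have intr_neq0 (K : fieldType) : (map_poly intr Q : {poly K}) != 0.
  by rewrite -size_poly_eq0 size_intr size_poly_eq0 monic_neq0.
have one_int : 1 = map_poly intr 1 :> {poly rat} by rewrite rmorph1.
(* The coefficient 1 of the denominator is the required p-adic unit. *)
exists (map_poly intr Q), 1; split.
- exact: oner_neq0.
- by rewrite tofrac1 divr1.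
- by move=> i; rewrite one_int !coef_map !p_integral_int.
- exists 0%N; apply/orP; right.
  rewrite coef1 /p_unit (p_integral_int 1) //= dvdz1.
  by case: p p_pr => [|[]].
- rewrite {1}one_int !reduce_int rmorph1.
  by rewrite !frac_deg_poly // !size_intr.
Qed.

Lemma quadratic_good_reduction (B C : int) :
  good_reduction ('X^2 + B%:~R *: 'X + (C%:~R)%:P)%:F.
Proof.
have -> : 'X^2 + B%:~R *: 'X + (C%:~R)%:P
        = map_poly intr ('X^2 + (B *: 'X + C%:P)) :> {poly rat}.
  by rewrite !rmorphD /= map_polyXn map_polyZ map_polyX map_polyC addrA.
apply: monic_int_good_reduction; rewrite monicE lead_coefDl ?lead_coefXn //.
rewrite size_polyXn ltnS (leq_trans (size_polyD _ _)) // geq_max.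
rewrite (leq_trans (size_scale_leq _ _)) ?size_polyX //.
by rewrite (leq_trans (size_polyC_leq1 _)).
Qed.

Theorem lemma4p3 (k : int)
    (hk : (k = 0 %[mod 4])%Z \/ (k = 1 %[mod 4])%Z) :
  exists B C : int,
    conjugate ('X^2 + (k%:~R / 4%:R)%:P)%:F
              ('X^2 + B%:~R *: 'X + (C%:~R)%:P)%:F
    /\ good_reduction ('X^2 + B%:~R *: 'X + (C%:~R)%:P)%:F.
Proof.
suff [b [B [C [defB defC]]]] : exists b : rat, exists B C : int,
    B%:~R = b *+ 2 /\ C%:~R = b ^+ 2 - b + k%:~R / 4%:R.
  exists B, C; split; last exact: quadratic_good_reduction.
  by rewrite defB defC; apply: conjugate_quadratic.
have := divz_eq k 4; set m := (k %/ 4)%Z.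
case: hk => -> ->; [exists 0, 0, m | exists 2^-1, 1, m].
  by rewrite mod0z; split; rewrite // rmorphD rmorphM /=; field.
by rewrite (_ : (1 %% 4)%Z = 1) //; split; rewrite // rmorphD rmorphM /=; field.
Qed.
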